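(* Let $C$ be a non-empty finite subset of $\mathbb{Z}$. The graph ${\rm G}(C)$ is a tree with root equal to $\max({\rm NI}(C))$, the maximum (with respect to inclusion) of ${\rm NI}(C)$. Moreover, the children of a vertex $S\in{\rm NI}(C)$ are the elements of the set $$\left\{S\setminus\{x\} : x\in{\rm msg}(S),\ x>{\rm F}(S),\ \text{and } S\setminus\{x\}\in{\rm NI}(C)\right\}.$$
   Context: $\mathbb{N}$ denotes the non-negative integers. For $C\subseteq\mathbb{Z}$, a $C$-incentive is a submonoid $M$ of $(\mathbb{N},+)$ such that $s+t+c\in M$ for all $s,t\in M\setminus\{0\}$ and all $c\in C$; it is numerical if $\gcd(M)=1$ (equivalently $\mathbb{N}\setminus M$ finite). ${\rm NI}(C)$ is the set of all numerical $C$-incentives; it has a maximum element with respect to inclusion. For a submonoid $S$ of $\mathbb{N}$ with $\gcd(S)=1$, ${\rm F}(S)$ is the greatest integer not in $S$. For a submonoid $M$ of $(\mathbb{N},+)$, ${\rm msg}(M)=(M\setminus\{0\})\setminus((M\setminus\{0\})+(M\setminus\{0\}))$ is its minimal system of generators. A graph is a pair $(V,E)$ with $V$ a non-empty set (vertices) and $E\subseteq\{(v,w)\in V\times V: v\ne w\}$ (edges). A path connecting $x$ and $y$ is a sequence of different edges $(v_0,v_1),(v_1,v_2),\ldots,(v_{n-1},v_n)$ with $v_0=x$, $v_n=y$. A graph is a tree with root $v^*$ if for every vertex $x\neq v^*$ there is a unique path connecting $x$ and $v^*$. If $(x,y)$ is an edge of the tree, $x$ is a child of $y$. The graph ${\rm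 G}(C)$ has vertex set ${\rm NI}(C)$, and $(S,S')\in{\rm NI}(C)\times{\rm NI}(C)$ is an edge iff $S'=S\cup\{{\rm F}(S)\}$. *)

(* Defs.v *)
From mathcomp Require Import all_boot all_order all_algebra.
From mathcomp Require Import boolp classical_sets cardinality.
Set Implicit Arguments.
Unset Strict Implicit.
Unset Printing Implicit Defensive.
Import Order.TTheory GRing.Theory Num.Theory.
Local Open Scope classical_set_scope.

Definition is_greatest d (T : porderType d) (A : set T) (m : T) : Prop :=
  A m /\ ubound A m.

(** * Submonoids of the natural numbers *)

(* A set of naturals seen as a set of integers. *)
Definition Zset (M : set nat) : set int := [set x%:Z%R | x in M].

Definition is_submonoid (M : set nat) : Prop := Algebra.nmod_closed (mem M).

Definition is_gcd (M : set nat) (g : nat) : Prop :=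
  (forall x, M x -> g %| x) /\
  (forall d, (forall x, M x -> d %| x) -> d %| g).

(* M \ {0} *)
Definition nonzero (M : set nat) : set nat := M `\ 0%N.

(* The greatest integer not in S. The value is an integer because
   F(N) = -1; the default 0 is only used when no greatest gap exists. *)
Definition frobenius (S : set nat) : int :=
  xget 0%R (is_greatest (~` Zset S)).

Definition msg (M : set nat) : set nat :=
  nonzero M `\` [set (s + t)%N | s in nonzero M & t in nonzero M].

(** * Incentives *)

(* Membership of s + t + c in M is stated in the integers, so in particular
   it forces s + t + c to be non-negative. *)
Definition incentive (C : set int) (M : set nat) : Prop :=
  is_submonoid M /\
  (forall s t c, nonzero M s -> nonzero M t -> C c ->
     Zset M (s%:Z + t%:Z + c)%R).

Definition NI (C : set int) : set (set nat) :=
  [set M | incentive C M /\ is_gcd M 1].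

(** * Graphs *)

Record graph (T : Type) := Graph { vertices : set T; edges : set (T * T) }.

Definition is_graph (T : Type) (G : graph T) : Prop :=
  vertices G !=set0 /\
  (forall v w, edges G (v, w) -> [/\ vertices G v, vertices G w & v <> w]).

(* es is [:: (v_0, v_1); (v_1, v_2); ...; (v_(n-1), v_n)] with v_0 = x,
   vs = [:: v_1; ...; v_n] and v_n = y. *)
Definition connecting_path (T : eqType) (G : graph T) (x y : T)
    (es : seq (T * T)) : Prop :=
  (exists vs : seq T, es = pairmap (fun v w => (v, w)) x vs /\ last x vs = y) /\
  {in es, forall e, edges G e} /\
  uniq es.

Definition is_tree_with_root (T : eqType) (G : graph T) (r : T) : Prop :=
  [/\ is_graph G, vertices G r &
      forall x, vertices G x -> x <> r ->
        exists! es : seq (T * T), connecting_path G x r es].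

Definition children (T : Type) (G : graph T) (y : T) : set T :=
  [set x | edges G (x, y)].

(* S' = S `|` {F(S)} is stated in the integers since F(S) may be -1. *)
Definition incentive_graph (C : set int) : graph (set nat) :=
  {| vertices := NI C;
     edges := [set e | [/\ NI C e.1, NI C e.2 &
                 Zset e.2 = Zset e.1 `|` [set frobenius e.1]]] |}.

(* Main.v *)
(** A vertex [S] other than the maximum has the single outgoing edge
    [S -> S `|` {F(S)}], and the Frobenius number decreases along it, so every
    vertex is joined to the maximum by exactly one path.  What has to be checked
    is that [S `|` {F(S)}] is again an incentive.  With [b = min C], every
    nonzero element of a numerical [C]-incentive is at least [d], where [d = 1] if
    [-2 <= b] and [d = - b] otherwise, and [{0} `|` [d, oo)] is the maximum of
    [NI C].  When [S] is not the maximum, [F(S) >= d], so a sum [s + t + c]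
    involving [F(S)] is at least [F(S)], except when [d = 1] and [F(S) = 1], and
    then [S `|` {F(S)}] is all of [N]. *)
Require Import Defs.
From mathcomp Require Import all_boot all_order all_algebra.
From mathcomp Require Import boolp classical_sets cardinality.
From mathcomp Require Import zify.
Import Order.TTheory GRing.Theory Num.Theory.
Local Open Scope classical_set_scope.

(** * Functional graphs with a rank function *)

Section FunctionalTree.
Variables (T : eqType) (G : graph T) (r : T) (rank : T -> nat).
Hypotheses (G_graph : is_graph G) (r_vertex : vertices G r).
Hypothesis edge_fun : forall x y z, edges G (x, y) -> edges G (x, z) -> y = z.
Hypothesis r_sink : forall y, ~ edges G (r, y).
Hypothesis edge_exists : forall x, vertices G x -> x <> r -> exists y, edges G (x, y).
Hypothesis edge_rank : forall x y, edges G (x, y) -> rank y < rank x.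

Let walk x vs : seq (T * T) := pairmap (fun v w => (v, w)) x vs.

Lemma walk_rank x vs :
  {in walk x vs, forall e, edges G e} ->
  {in walk x vs, forall e, rank e.1 <= rank x}.
Proof.
elim: vs x => [|y vs IH] x //= hE e; rewrite in_cons => /predU1P[-> //|he].
have lt_yx := edge_rank _ _ (hE (x, y) (mem_head _ _)).
apply: leq_trans (ltnW lt_yx).
by apply: IH he => e' he'; apply: hE; rewrite in_cons he' orbT.
Qed.

(** Every edge after the first starts at a vertex of rank at most [rank y < rank x], so the first
    edge never recurs. *)
Lemma walk_uniq x vs : {in walk x vs, forall e, edges G e} -> uniq (walk x vs).
Proof.
elim: vs x => [|y vs IH] x //= hE.
have hE' : {in walk y vs, forall e, edges G e}.
  by move=> e he; apply: hE; rewrite in_cons he orbT.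
rewrite IH // andbT; apply/negP => hx.
have := edge_rank _ _ (hE (x, y) (mem_head _ _)).
by rewrite ltnNge (walk_rank _ _ hE' _ hx).
Qed.

(** Outgoing edges are unique, so two walks from [x] agree until one stops; it stops at [r], which
    has no outgoing edge, so the other stops there too. *)
Lemma walk_to_root_inj x vs ws :
  {in walk x vs, forall e, edges G e} -> {in walk x ws, forall e, edges G e} ->
  last x vs = r -> last x ws = r -> vs = ws.
Proof.
elim: vs x ws => [|y vs IH] x [|z ws] //= hv hw.
- move=> xr _; case: (r_sink z); rewrite -xr.
  by apply: hw; rewrite mem_head.
- move=> _ xr; case: (r_sink y); rewrite -xr.
  by apply: hv; rewrite mem_head.
have yz : y = z by apply: (edge_fun x); [apply: hv | apply: hw]; rewrite mem_head.
rewrite -yz in hw * => lv lw; congr (_ :: _).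
by apply: (IH y) => // e he; [apply: hv | apply: hw]; rewrite in_cons he orbT.
Qed.

Lemma walk_to_root_exists x : vertices G x ->
  exists vs, {in walk x vs, forall e, edges G e} /\ last x vs = r.
Proof.
have [n] := ubnP (rank x); elim: n x => // n IH x lt_xn Gx.
have [->|xr] := pselect (x = r); first by exists [::].
have [y exy] := edge_exists _ Gx xr.
have [_ Gy _] := G_graph.2 _ _ exy.
have [vs [hvs lvs]] := IH y (leq_trans (edge_rank _ _ exy) lt_xn) Gy.
exists (y :: vs); split=> // e.
by rewrite in_cons => /predU1P[->//|]; apply: hvs.
Qed.

Lemma functional_tree : is_tree_with_root G r.
Proof.
split=> // x Gx _; have [vs [hvs lvs]] := walk_to_root_exists _ Gx.
exists (walk x vs); split.
  by split; [exists vs | split=> //; apply: walk_uniq].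
move=> _ [[ws [-> lws]] [hws _]].
by rewrite (walk_to_root_inj _ _ _ hvs hws lvs lws).
Qed.

End FunctionalTree.

(** * Numerical submonoids and their Frobenius number *)

Lemma Zset_nat (M : set nat) n : Zset M n%:Z%R <-> M n.
Proof. by split=> [[m Mm [<-]]//|Mn]; exists n. Qed.

Lemma Zset_inj : injective Zset.
Proof.
by move=> A B eAB; apply/seteqP; split=> n /Zset_nat; rewrite (eAB, =^~ eAB) => /Zset_nat.
Qed.

Lemma Zset_setU1 (M : set nat) n : Zset (M `|` [set n]) = Zset M `|` [set n%:Z%R].
Proof. by rewrite /Zset image_setU image_set1. Qed.

Section Submonoid.
Variable M : set nat.
Hypothesis subM : is_submonoid M.

Lemma submonoid0 : M 0.
Proof. exact: set_mem subM.1. Qed.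

Lemma submonoidD x y : M x -> M y -> M (x + y).
Proof. by move=> Mx My; exact: set_mem (subM.2 _ _ (mem_set Mx) (mem_set My)). Qed.

Lemma submonoidM k x : M x -> M (k * x).
Proof.
by move=> Mx; elim: k => [|k IH]; [exact: submonoid0 | rewrite mulSn; exact: submonoidD].
Qed.

(* The least positive difference of two elements divides every element, hence
   is 1. *)
Lemma submonoid_consecutive : is_gcd M 1 -> exists a, M a /\ M a.+1.
Proof.
move=> [_ gcdM].
pose P d := `[< 0 < d /\ exists a, M a /\ M (a + d) >].
have exP : exists d, P d.
  have [[x [Mx x0]]|noM] := pselect (exists x, M x /\ x <> 0).
    exists x; apply/asboolP; split; first by lia.
    by exists 0; split; [exact: submonoid0 | rewrite add0n].
  (* Were [M] reduced to 0, the number 2 would divide all of [M], hence 1. *)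
  have /gcdM : forall x, M x -> 2 %| x.
    by move=> x Mx; have [->//|/eqP x0] := eqVneq x 0; case: noM; exists x.
  by [].
case: (ex_minnP exP) => d /asboolP[d0 [a [Ma Mad]]] dmin.
have /gcdM : forall x, M x -> d %| x.
  move=> x Mx; apply/negPn/negP => ndx.
  have r0 : 0 < x %% d by rewrite lt0n.
  have : P (x %% d).
    (* With [q = x %/ d], both [q (a + d)] and [q a + x] are in [M], and they differ by the
       remainder, which is smaller than [d]. *)
    apply/asboolP; split=> //; exists (x %/ d * (a + d)); split.
      exact: submonoidM.
    have -> : x %/ d * (a + d) + x %% d = x %/ d * a + x.
      by rewrite mulnDr -addnA -divn_eq.
    by apply: submonoidD => //; exact: submonoidM.
  by move=> /dmin; rewrite leqNgt ltn_pmod.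
by rewrite dvdn1 => /eqP d1; exists a; rewrite d1 addn1 in Mad.
Qed.

(** For [a] and [a + 1] in [M], division by [a] gives [n = q a + r = (q - r) a + r (a + 1)], where
    [r < a <= q] once [n] is at least the square of [a]. *)
Lemma submonoid_cofinite : is_gcd M 1 -> exists N, forall n, N <= n -> M n.
Proof.
move=> /submonoid_consecutive [a [Ma Ma1]]; exists (a * a) => n le_n.
have [a0|a0] := posnP a.
  by rewrite -[n]muln1; apply: submonoidM; rewrite a0 in Ma1.
have lt_r : n %% a < a by rewrite ltn_pmod.
have le_q : a <= n %/ a by rewrite leq_divRL.
have -> : n = (n %/ a - n %% a) * a + n %% a * a.+1.
  by rewrite mulnS addnCA -mulnDl subnK 1?addnC -?divn_eq//; lia.
by apply: submonoidD; exact: submonoidM.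
Qed.

End Submonoid.

Lemma is_greatest_unique d (T : porderType d) (A : set T) m m' :
  is_greatest A m -> is_greatest A m' -> m = m'.
Proof. by move=> [Am mA] [Am' mA']; apply: le_anti; rewrite mA' ?mA. Qed.

Lemma frobeniusE (S : set nat) z : is_greatest (~` Zset S) z -> frobenius S = z.
Proof.
move=> Sz; apply: (is_greatest_unique _ _ _ _ _ _ Sz).
by apply: (xgetPex 0%R); exists z.
Qed.

Lemma gap_greatest (S : set nat) n :
  ~ S n -> (forall m, n < m -> S m) -> is_greatest (~` Zset S) n%:Z%R.
Proof.
move=> Sn ltS; split=> [/Zset_nat//|[m|m]] Sm; last by [].
by rewrite lez_nat leqNgt; apply/negP => /ltS/Zset_nat.
Qed.

Section Numerical.
Variable S : set nat.
Hypotheses (subS : is_submonoid S) (gcdS : is_gcd S 1).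

Lemma frobenius_greatest : is_greatest (~` Zset S) (frobenius S).
Proof.
suff [z Sz] : exists z, is_greatest (~` Zset S) z by rewrite (frobeniusE _ _ Sz).
have [N SN] := submonoid_cofinite _ subS gcdS.
have [[n Sn]|noS] := pselect (exists n, ~ S n).
  have exP : exists n, `[< ~ S n >] by exists n; apply/asboolP.
  have ubP m : `[< ~ S m >] -> m <= N.
    by move=> /asboolP Sm; rewrite leqNgt; apply/negP => /ltnW/SN.
  case: (ex_maxnP exP ubP) => k /asboolP Sk kmax; exists k%:Z%R.
  apply: gap_greatest => // m lt_km; apply: contrapT => Sm.
  by have := kmax m (asboolT Sm); rewrite leqNgt lt_km.
(* Here [S] is all of the naturals. *)
exists (-1)%R; split=> [[]//|[m|m] Sm]; last by [].
by case: Sm; apply/Zset_nat; apply: contrapT => Sm; case: noS; exists m.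
Qed.

Lemma frobenius_ge : (-1 <= frobenius S)%R.
Proof. by apply: frobenius_greatest.2 => -[]. Qed.

Lemma frobenius_gap n : frobenius S = n%:Z%R -> ~ S n /\ forall m, n < m -> S m.
Proof.
move=> Fn; have [] := frobenius_greatest; rewrite Fn => Sn ub; split.
  by move/Zset_nat.
move=> m lt_nm; apply: contrapT => Sm.
have /ub : (~` Zset S) m%:Z%R by move/Zset_nat.
by rewrite lez_nat leqNgt lt_nm.
Qed.

Lemma frobenius_nat m : ~ S m -> exists n, frobenius S = n%:Z%R /\ m <= n.
Proof.
move=> Sm; have /frobenius_greatest.2 : (~` Zset S) m%:Z%R by move/Zset_nat.
by case: (frobenius S) => // n; rewrite lez_nat => le_mn; exists n.
Qed.

End Numerical.

(** * The maximum numerical incentive *)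

Definition ray (d : nat) : set nat := [set n | n = 0 \/ d <= n].

(* [b] stands for the minimum of [C]. *)
Definition threshold (b : int) : nat := if (-2 <= b)%R then 1 else `|b|%N.

Lemma min_exists (C : set int) : finite_set C -> C !=set0 ->
  exists2 b, C b & forall c, C c -> (b <= c)%R.
Proof.
move=> /finite_seqP[s ->] [x xs].
exists (\big[Num.min/x]_(i <- s) i)%R => [|c cs]; last exact: ge_bigmin_seq.
rewrite /= big_seq; elim/big_ind: _ => //= y z ys zs.
by rewrite /Order.min; case: ifP.
Qed.

Section MaxIncentive.
Variables (C : set int) (b : int).
Hypotheses (Cb : C b) (b_min : forall c, C c -> (b <= c)%R).
Let d := threshold b.

Lemma threshold_gt0 : 0 < d.
Proof. by rewrite /d /threshold; case: ifP; lia. Qed.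

(** For [b < -2], let [s] be the least nonzero element: [2 s + b] lies in [M], so it is 0 or at
    least [s]. The latter means [s >= - b]; the former forces [s = 1] by the gcd, hence [b = -2]. *)
Lemma NI_ge_threshold M n : NI C M -> nonzero M n -> d <= n.
Proof.
move=> [[subM incM] gcdM] [Mn n0].
have {}n0 : n <> 0 by [].
rewrite /d /threshold; case: ifPn => [_|b3]; first by lia.
pose P k := `[< nonzero M k >].
have exP : exists k, P k by exists n; apply/asboolP.
case: (ex_minnP exP) => s /asboolP[Ms s0] smin.
have {}s0 : s <> 0 by [].
have le_sn : s <= n by apply: smin; apply/asboolP.
have [k Mk ks] := incM s s b (conj Ms s0) (conj Ms s0) Cb.
have [k0|k0] := eqVneq k 0; last first.
  have : s <= k by apply: smin; apply/asboolP; split=> //; apply/eqP.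
  lia.
(* Here [2 s = - b], so [M] is closed under subtracting [s] from its nonzero
   elements, and [s] divides all of [M]. *)
have /(gcdM.2 s) : forall x, M x -> s %| x.
  move=> x; have [m] := ubnP x; elim: m x => // m IH x lt_xm Mx.
  have [->//|/eqP x0] := eqVneq x 0.
  have [y My yx] := incM x s b (conj Mx x0) (conj Ms s0) Cb.
  have -> : x = y + s by lia.
  by rewrite dvdn_addl //; apply: IH => //; lia.
rewrite dvdn1 => /eqP s1; lia.
Qed.

Lemma ray_NI : NI C (ray d).
Proof.
have d0 := threshold_gt0.
(* The gcd is 1 because the ray contains both [d] and [d + 1]. *)
split; last first.
  split=> // g gM; rewrite -(dvdn_addr (m := d)); last by apply: gM; right.
  by rewrite addn1; apply: gM; right.
split.
  split; first by apply: mem_set; left.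
  move=> x y /set_mem hx /set_mem hy; apply: mem_set.
  rewrite /ray /= in hx hy *; rewrite -[(x + y)%R]/(x + y)%N; lia.
move=> s t c [hs s0] [ht t0] Cc; rewrite /ray /= in hs ht s0 t0.
have bc := b_min _ Cc.
(* The sum is at least [2 d + b]: this is [d] if [d = - b], and nonnegative if [d = 1], when the ray
   is everything. *)
exists `|(s%:Z + t%:Z + c)%R|%N; move: hs ht s0 t0 d0; rewrite /ray /d /threshold /=; case: ifP; lia.
Qed.

Lemma ray_greatest : is_greatest (NI C) (ray d).
Proof.
split; first exact: ray_NI.
move=> M NM; rewrite subsetEset => n Mn.
have [->|/eqP n0] := eqVneq n 0; first by left.
by right; apply: NI_ge_threshold NM _.
Qed.

Lemma NI_setU_frobenius S : NI C S -> S <> ray d ->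
  exists2 n, frobenius S = n%:Z%R & NI C (S `|` [set n]).
Proof.
move=> NS neS; have [[subS incS] gcdS] := NS.
have d0 := threshold_gt0.
have S0 := submonoid0 _ subS.
have geS x : nonzero S x -> d <= x by apply: NI_ge_threshold.
have [x le_dx Sx] : exists2 x, d <= x & ~ S x.
  apply: contrapT => nex; apply: neS; apply/seteqP; split=> x.
    move=> Sx; have [->|/eqP x0] := eqVneq x 0; first by left.
    by right; apply: geS.
  by move=> [->//|le_dx]; apply: contrapT => Sx; apply: nex; exists x.
have [n [Fn le_xn]] := frobenius_nat _ subS gcdS _ Sx.
have [Sn gtS] := frobenius_gap _ subS gcdS _ Fn.
exists n => //; set S' := _ `|` _.
have geS' m : n <= m -> S' m.
  by rewrite leq_eqVlt => /predU1P[<-|/gtS]; [right | left].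
have gcdS' : is_gcd S' 1 by split=> // g gS'; apply: gcdS.2 => y Sy; apply: gS'; left.
split=> //; split.
  split; first by apply: mem_set; left.
  move=> y z /set_mem[Sy|->] /set_mem[Sz|->]; apply: mem_set;
    rewrite -?[(_ + _)%R]/(_ + _)%N; try (apply: geS'; lia).
  by left; apply: submonoidD.
(* These are the sums with a summand [n]; the other summand may be [n] as well. *)
have incn t c : t <> 0 -> d <= t -> (S t \/ t = n) -> C c -> Zset S' (n%:Z + t%:Z + c)%R.
  move=> t0 le_dt St Cc; have bc := b_min _ Cc.
  have [t1|t1] := eqVneq t 1.
    (* If 1 were in [S], so would be [n]. Hence [t = n = 1], and [S'] is everything. *)
    have {St}tn : t = n.
      case: St => // St; case: Sn; rewrite -[n]muln1; apply: submonoidM => //.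
      by rewrite -t1.
    have ge2 k : 2 <= k -> S' k by move=> k2; apply: geS'; lia.
    have Sk k : S' k.
      case: k => [|[|k]]; [by left | by apply: geS'; lia | exact: ge2].
    exists `|(n%:Z + t%:Z + c)%R|%N => //.
    by move: le_dt; rewrite /d /threshold; case: ifP; lia.
  (* Now [t >= 2] and [t >= d] give [t + c >= 0], so the sum is at least [n]. *)
  exists `|(n%:Z + t%:Z + c)%R|%N.
    by apply: geS'; move: le_dt; rewrite /d /threshold; case: ifP; lia.
  by move: le_dt; rewrite /d /threshold; case: ifP; lia.
move=> s t c [hs s0] [ht t0] Cc.
have {}s0 : s <> 0 by [].
have {}t0 : t <> 0 by [].
case: ht => [St|tn]; last first.
  rewrite tn [X in (X + _)%R]addrC; apply: incn => //.
  by case: hs => [Ss|->]; [apply: geS | lia].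
case: hs => [Ss|->]; last by apply: incn => //; [apply: geS | left].
by rewrite /S' Zset_setU1; left; apply: incS.
Qed.

End MaxIncentive.

(** * The graph of numerical incentives *)

(** An edge puts [frobenius S] into [Zset S'], which excludes the value -1, so the condition can be
    read in the naturals. *)
Lemma incentive_edgeP (C : set int) S S' :
  edges (incentive_graph C) (S, S') <->
  [/\ NI C S, NI C S' &
      exists2 n, frobenius S = n%:Z%R & S' = S `|` [set n]].
Proof.
split=> [[/= NS NS' eS']|[NS NS' [n Fn eS']]]; split=> //=.
  have : Zset S' (frobenius S) by rewrite eS'; right.
  move=> [n _ Fn]; exists n => //; apply: Zset_inj.
  by rewrite eS' -Fn Zset_setU1.
by rewrite eS' Zset_setU1 Fn.
Qed.

(** Gaps of [S'] are gaps of [S], and [frobenius S] is no longer one. *)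
Lemma frobenius_edge (C : set int) S S' :
  edges (incentive_graph C) (S, S') -> (frobenius S' < frobenius S)%R.
Proof.
move=> /incentive_edgeP[[[subS _] gcdS] [[subS' _] gcdS'] [n Fn eS']].
have [Sn _] := frobenius_greatest _ subS' gcdS'.
rewrite lt_neqAle; apply/andP; split.
  by apply/eqP => FF; apply: Sn; rewrite FF Fn; apply/Zset_nat; rewrite eS'; right.
apply: (frobenius_greatest _ subS gcdS).2 => Sn'; apply: Sn.
by rewrite {1}eS' Zset_setU1; left.
Qed.

Lemma incentive_graph_is_graph (C : set int) :
  NI C !=set0 -> is_graph (incentive_graph C).
Proof.
move=> NI0; split=> // S S' e; have := frobenius_edge _ _ _ e.
case: e => /= NS NS' _ ltF; split=> // eS.
by rewrite eS ltxx in ltF.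
Qed.

Lemma incentive_graph_tree (C : set int) (b : int) :
  C b -> (forall c, C c -> (b <= c)%R) ->
  is_tree_with_root (incentive_graph C) (ray (threshold b)).
Proof.
move=> Cb b_min; have [NR maxR] := ray_greatest _ _ Cb b_min.
(* Frobenius numbers are at least -1, so the shift by 1 makes the rank a natural number. *)
apply: (functional_tree _ _ _ (fun S => `|(frobenius S + 1)%R|%N)) => //.
- by apply: incentive_graph_is_graph; exists (ray (threshold b)).
- move=> S S1 S2 /incentive_edgeP[_ _ [n Fn ->]] /incentive_edgeP[_ _ [m Fm ->]].
  by move: Fm; rewrite Fn => -[->].
(* An edge leaving the maximum would reach a strictly larger incentive. *)
- move=> S' /incentive_edgeP[[[subR _] gcdR] NS' [n Fn eS']].
  have [] := frobenius_gap _ subR gcdR _ Fn; case.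
  have := maxR _ NS'; rewrite subsetEset; apply.
  by rewrite eS'; right.
- move=> S NS neS; have [n Fn NS'] := NI_setU_frobenius _ _ Cb b_min _ NS neS.
  by exists (S `|` [set n]); apply/incentive_edgeP; split=> //; exists n.
move=> S S' e; have ltF := frobenius_edge _ _ _ e.
case: e => /= -[[subS _] gcdS] [[subS' _] gcdS'] _.
have := frobenius_ge _ subS gcdS; have := frobenius_ge _ subS' gcdS'; lia.
Qed.

(** A child arises from [S] by removing the Frobenius number of the child, which exceeds that of
    [S]. Conversely, removing some [x] above [frobenius S] makes [x] the greatest gap. *)
Lemma incentive_graph_children (C : set int) S : NI C S ->
  children (incentive_graph C) S =
  [set S `\ x | x in [set x | [/\ msg S x, (frobenius S < x%:Z)%R
                                 & NI C (S `\ x)]]].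
Proof.
move=> NS; apply/seteqP; split=> S'; last first.
  move=> [x [[[Sx _] _] ltFx NSx] <-]; apply/incentive_edgeP; split=> //.
  exists x; last by rewrite setUC setDUK// => _ ->.
  apply: frobeniusE; apply: gap_greatest => [[_]|m lt_xm]; first exact.
  split=> [|/= mx]; last by rewrite mx ltnn in lt_xm.
  have [[subS _] gcdS] := NS.
  apply: contrapT => Sm; have [n [Fn le_mn]] := frobenius_nat _ subS gcdS _ Sm.
  move: ltFx; rewrite Fn ltz_nat; lia.
move=> e; have ltF := frobenius_edge _ _ _ e.
have /incentive_edgeP[NS' _ [n Fn eS]] := e.
have [[subS' _] gcdS'] := NS'.
have [Sn gtS] := frobenius_gap _ subS' gcdS' _ Fn.
have eS' : S `\ n = S'.
  rewrite eS setDUl setDv setU0; apply/seteqP; split=> [m []//|m Sm].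
  by split=> // mn; apply: Sn; rewrite -mn.
exists n => //; split; [|by rewrite -Fn|by rewrite eS'].
have n0 : n <> 0 by move=> n0; apply: Sn; rewrite n0; exact: submonoid0.
split; first by split=> //; rewrite eS; right.
move=> [s [Ss s0] [t [St t0] stn]].
have {}s0 : s <> 0 by [].
have {}t0 : t <> 0 by [].
(* Both summands are nonzero, so they differ from [n] and stay in [S'], as does their sum [n]. *)
apply: Sn; rewrite -stn; apply: submonoidD => //; rewrite -eS'; split=> //= ?; lia.
Qed.

Theorem theorem6p1 (C : set int) (C_finite : finite_set C)
    (C_nonempty : C !=set0) :
  (exists M : set nat,
     is_greatest (NI C) M /\ is_tree_with_root (incentive_graph C) M) /\
  (forall S : set nat, NI C S ->
     children (incentive_graph C) S =
     [set S `\ x | x in [set x | [/\ msg S x, (frobenius S < x%:Z)%R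
                                    & NI C (S `\ x)]]]).
Proof.
split; last by move=> S; apply: incentive_graph_children.
have [b Cb b_min] := min_exists _ C_finite C_nonempty.
exists (ray (threshold b)).
by split; [apply: ray_greatest | apply: incentive_graph_tree].
Qed.
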